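(* Let $d\geq 3$. There exists a constant $C=C_d>0$, depending only on $d$, such that for every odd prime power $q$: if $E\subset \mathbb{F}_q^d$ satisfies $|E|>Cq^{d-1}$, then the $t$-distance graph $G_t(E)$ has VC-dimension at least $d$ for every $t\in\mathbb{F}_q\setminus \{0\}$.
   Context: For $x,y\in\mathbb{F}_q^d$ write $\|x-y\|=\sum_{i=1}^d (x_i-y_i)^2\in\mathbb{F}_q$. For $E\subset\mathbb{F}_q^d$ and $t\in\mathbb{F}_q$, the $t$-distance graph $G_t(E)$ is the graph with vertex set $E$ in which $x\sim y$ if and only if $\|x-y\|=t$. VC-dimension: if $V$ is a set and $\mathcal{H}\subset\{0,1\}^V$ is a family of functions, $\mathcal{H}$ shatters a finite set $S\subset V$ if $\{0,1\}^S=\{h|_S:h\in\mathcal{H}\}$; the VC-dimension of $\mathcal{H}$ is the largest $n$ such that $\mathcal{H}$ shatters some set of size $n$ (infinite if no such $n$ exists). For a graph $G$ with vertex set $V$, let $N(x)=\{y\in V:x\sim y\}$ and $N[x]=\{x\}\cup N(x)$ be the neighborhood and closed neighborhood of $x\in V$. The VC-dimension of the graph $G$ is the VC-dimension of the family $\{\mathbf{1}_{N[x]}:x\in V\}$ of indicator functions. *)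

(* Defs.v *)
From mathcomp Require Import all_boot all_order all_algebra.

Set Implicit Arguments.
Unset Strict Implicit.
Unset Printing Implicit Defensive.

Section VCDimension.
Variable V : finType.

Definition restriction (h : {ffun V -> bool}) (S : {set V}) :
    {ffun {y : V | y \in S} -> bool} :=
  [ffun y => h (val y)].

Definition shatters (H : {set {ffun V -> bool}}) (S : {set V}) : bool :=
  [set restriction h S | h in H] == [set: {ffun {y : V | y \in S} -> bool}].

(* V is finite, so the largest size of a shattered set always exists, except
   when H is empty (then nothing is shattered, and the value is 0). *)
Definition VCdim (H : {set {ffun V -> bool}}) : nat :=
  \max_(S : {set V} | shatters H S) #|S|.

Definition neighborhood (e : rel V) (x : V) : {set V} := [set y | e x y].

Definition closed_neighborhood (e : rel V) (x : V) : {set V} :=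
  x |: neighborhood e x.

Definition indicator (A : {set V}) : {ffun V -> bool} := [ffun y => y \in A].

Definition graph_VCdim (e : rel V) : nat :=
  VCdim [set indicator (closed_neighborhood e x) | x : V].

End VCDimension.

Section DistanceGraph.
Import GRing.Theory.
Local Open Scope ring_scope.
Variables (F : finFieldType) (d : nat).

(* An element of F, not a norm in the metric sense. *)
Definition sqnorm (z : 'rV[F]_d) : F := \sum_(i < d) z 0 i ^+ 2.

(* The vertex type is the subtype of the points of E, so that both the centres
   of the neighborhoods and the shattered sets are confined to E. *)
Definition distance_graph (E : {set 'rV[F]_d}) (t : F) :
    rel {x : 'rV[F]_d | x \in E} :=
  fun x y => sqnorm (val x - val y) == t.

End DistanceGraph.

(* Main.v *)
Require Import Defs.
From mathcomp Require Import all_boot all_order all_algebra finfield.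
From mathcomp Require Import reals zify ring lra.

(** Write [q] for the order of the field and [n] for that of [E], so [n] is a
large multiple of [q ^ (d - 1)].  In the mean square, a point has about [n / q]
neighbours in [E].  For [d >= 4] this follows from point-hyperplane incidences
on the paraboloid in dimension [d + 1].  That bound loses a factor [sqrt q] when
[d = 3]; there two spheres of equal radius meet in a conic, with at most [q + 2]
points unless their centres are at distance [0] or [4 t], and the number of
exceptional pairs is in turn bounded through the mean square itself.

Consider stars: an apex [y] of typical degree and neighbours [x_1, ..., x_d] of
[y] in [E].  Only a small proportion of them have a set [I] of leaves with
fewer than [5 d q ^ (d - 1 - #|I|)] common neighbours in [E], or have dependent
vectors [x_i - y].  Fix a star of neither kind.  Adding a leaf to [I] cuts the
common neighbours down to at most [4 q ^ (d - 1 - #|I|)], because, by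
independence, the spheres about [j] leaves meet in a proper quadric of a flat
of dimension [d - j + 1].  So for each proper [I] some point of [E] is adjacent
to exactly the leaves in [I], while [y] is adjacent to all of them. *)

Import Order.TTheory GRing.Theory Num.Theory.
Local Open Scope ring_scope.

(** * Counting by fibres and double counting *)

Section Counting.
Set Implicit Arguments.
Unset Strict Implicit.

Lemma card_fibers (T T' : finType) (f : T -> T') (A : {set T}) (B : {set T'}) :
  (forall x, x \in A -> f x \in B) ->
  #|A| = (\sum_(b in B) #|[set x in A | f x == b]|)%N.
Proof.
move=> fAB; rewrite -sum1_card (partition_big f (mem B)) //=.
by apply: eq_bigr => b _; rewrite -sum1_card; apply: eq_bigl => x; rewrite inE.
Qed.

Lemma leq_card_fibers (T T' : finType) (f : T -> T') (A : {set T})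
    (B : {set T'}) (m : nat) :
  (forall x, x \in A -> f x \in B) ->
  (forall b, b \in B -> (#|[set x in A | f x == b]| <= m)%N) ->
  (#|A| <= #|B| * m)%N.
Proof.
move=> fAB fib; rewrite (card_fibers fAB) -sum_nat_const.
exact: leq_sum.
Qed.

Lemma geq_card_fibers (T T' : finType) (f : T -> T') (A : {set T})
    (B : {set T'}) (m : nat) :
  (forall b, b \in B -> (m <= #|[set x in A | f x == b]|)%N) ->
  (#|B| * m <= #|A|)%N.
Proof.
move=> fib; pose A' := [set x in A | f x \in B].
have sA : (#|A'| <= #|A|)%N by apply/subset_leq_card/subsetP=> x; rewrite inE; case/andP.
apply: leq_trans sA; rewrite (card_fibers (f := f) (B := B)); last first.
  by move=> x; rewrite inE => /andP[].
rewrite -sum_nat_const; apply: leq_sum => b bB.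
apply: leq_trans (fib b bB) _; apply/subset_leq_card/subsetP => x.
by rewrite !inE => /andP[-> /eqP->]; rewrite bB eqxx.
Qed.

Lemma leq_card_inj (T T' : finType) (f : T -> T') (A : {set T})
    (B : {set T'}) :
  (forall x, x \in A -> f x \in B) -> {in A &, injective f} ->
  (#|A| <= #|B|)%N.
Proof.
move=> fAB inj; rewrite -(card_in_imset inj); apply/subset_leq_card/subsetP.
by move=> _ /imsetP[x xA ->]; apply: fAB.
Qed.

Lemma sum_card_rel (X Y : finType) (E : {set X}) (r : X -> Y -> bool) :
  (\sum_y #|[set x in E | r x y]| = \sum_(x in E) #|[set y | r x y]|)%N.
Proof.
have cardE y : #|[set x in E | r x y]| = (\sum_(x in E) r x y)%N.
  rewrite -sum1_card big_mkcond [RHS]big_mkcond /=.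
  by apply: eq_bigr => x _; rewrite inE; case: (x \in E) (r x y) => [] [].
under eq_bigr => y _ do rewrite cardE.
rewrite exchange_big; apply: eq_bigr => x _ /=.
rewrite -sum1_card [RHS]big_mkcond /=; apply: eq_bigr => y _.
by rewrite inE; case: (r x y).
Qed.

(** A squared fibre size counts ordered pairs in the fibre, so this is double counting applied to
    [setX E E]. *)
Lemma sum_sqr_card_rel (X Y : finType) (E : {set X}) (r : X -> Y -> bool) :
  (\sum_y #|[set x in E | r x y]| ^ 2 =
   \sum_(x in E) \sum_(x' in E) #|[set y | r x y && r x' y]|)%N.
Proof.
have := sum_card_rel (setX E E) (fun (p : X * X) y => r p.1 y && r p.2 y).
rewrite pair_big /= => eq1.
rewrite [RHS](eq_bigl (mem (setX E E))); last by move=> [a b]; rewrite /= !inE.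
rewrite -[RHS]eq1; apply: eq_bigr => y _.
rewrite -mulnn -cardsX; congr (#|pred_of_set _|).
by apply/setP=> -[a b]; rewrite !inE /=; do 2!case: (_ \in E); rewrite ?andbT ?andbF.
Qed.

Lemma card_pffun_set (aT rT : finType) (y0 : rT) (D : {set aT}) (R : {set rT}) :
  #|[set g : {ffun aT -> rT} | g \in pffun_on y0 D R]| = (#|R| ^ #|D|)%N.
Proof. by rewrite -(card_pffun_on y0); apply: eq_card => g; rewrite [LHS]inE. Qed.

Lemma leq_expl (m1 m2 e : nat) : (m1 <= m2)%N -> (m1 ^ e <= m2 ^ e)%N.
Proof. by case: e => [|e] h; rewrite ?expn0 ?leq_exp2r. Qed.

End Counting.

(** * Roots of quadratics and points on conics over a finite field *)

Section FiniteField.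
Set Implicit Arguments.
Unset Strict Implicit.
Variable F : finFieldType.

Lemma two_neq0_of_odd_card : odd #|F| -> 2 != 0 :> F.
Proof.
move=> oddF; apply/eqP => F2.
have ch2 : 2%N \in [pchar F] by rewrite inE /= F2.
have := card_finNzRing_gt1 F; have := oddF.
by rewrite (card_pprimeChar ch2) oddX; case: (logn _ _).
Qed.

(** By Vieta, a root [x] leaves only [- b / c - x] as another root. *)
Lemma card_quadratic_roots (a b c : F) : c != 0 ->
  (#|[set x : F | (a + b * x + c * x ^+ 2 == 0)%R]| <= 2)%N.
Proof.
move=> c0; set A := [set _ | _].
have [->|[x xA]] := set_0Vmem A; first by rewrite cards0.
apply: leq_trans (_ : #|[set x; (- b / c - x)%R]| <= 2)%N; last by rewrite cards2; case: (_ != _).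
apply/subset_leq_card/subsetP => y yA.
rewrite !inE; apply/orP.
move: xA yA; rewrite !inE => /eqP xA /eqP yA.
case: (y =P x) => [->|/eqP neq]; [by left | right].
have : (y - x) * (b + c * (y + x)) = 0.
  have -> : (y - x) * (b + c * (y + x)) =
    (a + b * y + c * y ^+ 2) - (a + b * x + c * x ^+ 2) by ring.
  by rewrite xA yA subrr.
move/eqP; rewrite mulf_eq0 subr_eq0 (negPf neq) /= => /eqP e.
apply/eqP; have -> : b = - (c * (y + x)) by apply/eqP; rewrite -addr_eq0 e.
by field.
Qed.

Lemma card_sqr_roots (c : F) : (#|[set x : F | (x ^+ 2 == c)%R]| <= 2)%N.
Proof.
have := @card_quadratic_roots (- c) 0 1 (oner_neq0 _).
by congr (#|pred_of_set _| <= 2)%N; apply/setP => x; rewrite !inE mul0r addr0 mul1r addrC subr_eq0.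
Qed.

(* Project from a point of the conic: each line through it meets the conic in
   at most one further point. *)
Lemma card_conic_le (s m : F) : odd #|F| -> s != 0 -> m != 0 ->
  (#|[set p : F * F | (p.1 ^+ 2 + s * p.2 ^+ 2 == m)%R]| <= #|F| + 2)%N.
Proof.
move=> oddF s0 m0; have F2 := two_neq0_of_odd_card oddF.
set A := [set _ | _].
have [->|[[x0 y0] pA]] := set_0Vmem A; first by rewrite cards0.
(* [None] stands for the line [p.2 = y0]. The [q + 1] lines through the base point, together with
   that point, give the bound [q + 2]. *)
pose f (p : F * F) :=
  if p.2 == y0 then None else Some ((p.1 - x0) / (p.2 - y0)).
rewrite (cardsD1 (x0, y0)) pA addnC addn2 addn1 ltnS -card_option -cardsT.
apply: (leq_card_inj (f := f)) => [x _|]; first by rewrite inE.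
move: pA; rewrite inE /= => /eqP pA.
move=> [x y] [x' y']; rewrite !inE /f /=.
rewrite !xpair_eqE.
case: (y =P y0) => [-> | /eqP yy0]; case: (y' =P y0) => [-> | /eqP yy0'] //=.
- rewrite !andbT => /andP[xx0 /eqP e] /andP[xx0' /eqP e'] _.
  suff [-> ->]: x = - x0 /\ x' = - x0 by [].
  have h z : z != x0 -> z ^+ 2 + s * y0 ^+ 2 = m -> z = - x0.
    move=> zx ez; have : (z - x0) * (z + x0) = 0.
      have -> : (z - x0) * (z + x0) =
        (z ^+ 2 + s * y0 ^+ 2) - (x0 ^+ 2 + s * y0 ^+ 2) by ring.
      by rewrite ez pA subrr.
    by move/eqP; rewrite mulf_eq0 subr_eq0 (negPf zx) /= addr_eq0 => /eqP.
  by split; apply: h.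
rewrite !andbF /= => /eqP e /eqP e' [].
set k := _ / _ => /esym ek.
have ex : x = x0 + k * (y - y0) by rewrite /k; field; rewrite subr_eq0.
have ex' : x' = x0 + k * (y' - y0) by rewrite -ek; field; rewrite subr_eq0.
have line z : z != y0 -> (x0 + k * (z - y0)) ^+ 2 + s * z ^+ 2 = m ->
    2 * (k * x0 + s * y0) + (k ^+ 2 + s) * (z - y0) = 0.
  move=> zy ez; have : (z - y0) * (2 * (k * x0 + s * y0) + (k ^+ 2 + s) * (z - y0)) = 0.
    have -> : (z - y0) * (2 * (k * x0 + s * y0) + (k ^+ 2 + s) * (z - y0)) =
      ((x0 + k * (z - y0)) ^+ 2 + s * z ^+ 2) - (x0 ^+ 2 + s * y0 ^+ 2) by ring.
    by rewrite ez pA subrr.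
  by move/eqP; rewrite mulf_eq0 subr_eq0 (negPf zy) /= => /eqP.
move: (line y yy0) (line y' yy0'); rewrite -ex -ex' => /(_ e) l1 /(_ e') l2.
have : (k ^+ 2 + s) * (y - y') = 0.
  have -> : (k ^+ 2 + s) * (y - y') =
   (2 * (k * x0 + s * y0) + (k ^+ 2 + s) * (y - y0)) -
   (2 * (k * x0 + s * y0) + (k ^+ 2 + s) * (y' - y0)) by ring.
  by rewrite l1 l2 subrr.
(* In a direction with [k ^ 2 = - s] the equation along the line would force [x0 = k * y0], hence
   [m = 0]. *)
move/eqP; rewrite mulf_eq0 => /orP[/eqP ks | ]; last first.
  by rewrite subr_eq0 => /eqP eyy; rewrite ex ex' eyy.
move: l1; rewrite ks mul0r addr0 => /eqP; rewrite mulf_eq0 (negPf F2) /= => /eqP l1.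
have es : s = - k ^+ 2 by apply/eqP; rewrite -addr_eq0 addrC ks.
have : k * (x0 - k * y0) = 0 by rewrite -l1 es; ring.
move/eqP; rewrite mulf_eq0 => /orP[/eqP k0 | ].
  by move: s0; rewrite es k0 expr0n /= oppr0 eqxx.
rewrite subr_eq0 => /eqP xk.
move: m0; rewrite -pA es xk.
by have -> : (k * y0) ^+ 2 + - k ^+ 2 * y0 ^+ 2 = 0; [ring | rewrite eqxx].
Qed.

(** Squares, and likewise [m] minus squares, fill at least half of the field; if the two sets were
    disjoint, each would be exactly half, and the order would be even. *)
Lemma sum_two_squares (m : F) : odd #|F| ->
  exists x y : F, x ^+ 2 + y ^+ 2 = m.
Proof.
move=> oddF; pose A := [set x ^+ 2 | x : F]; pose B := [set m - a | a in A].
have cA : (#|F| <= #|A| * 2)%N.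
  rewrite -cardsT; apply: (leq_card_fibers (f := fun x : F => x ^+ 2)).
    by move=> x _; apply: imset_f.
  move=> b _; apply: leq_trans (card_sqr_roots b).
  by apply/subset_leq_card/subsetP=> x; rewrite !inE.
have cB : #|B| = #|A| by rewrite card_imset // => x y /addrI /oppr_inj.
have : A :&: B != set0.
  apply: contraTneq oddF => AB0.
  have := cardsUI A B; rewrite AB0 cards0 cB addn0 => cU.
  have : (#|A :|: B| <= #|F|)%N by exact: max_card.
  rewrite cU; move: cA => /[swap] h1 h2.
  have -> : #|F| = (#|A| * 2)%N by lia.
  by rewrite oddM andbF.
case/set0Pn => _ /setIP[/imsetP[x _ ->] /imsetP[_ /imsetP[y _ ->] e]].
by exists x, y; rewrite e subrK.
Qed.

(* Stereographic projection from a point of the conic, followed backwards. *)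
Lemma card_circle_ge (m : F) : odd #|F| -> m != 0 ->
  (#|F| - 2 <= #|[set p : F * F | (p.1 ^+ 2 + p.2 ^+ 2 == m)%R]|)%N.
Proof.
move=> oddF m0; have F2 := two_neq0_of_odd_card oddF.
have [x0 [y0 pA]] := sum_two_squares m oddF.
(* The at most two directions left out are the isotropic ones, where the denominator of [h]
   vanishes. *)
pose K := ~: [set k : F | k ^+ 2 == -1].
have cK : (#|F| - 2 <= #|K|)%N.
  by rewrite leq_subLR -(cardsC [set k : F | k ^+ 2 == -1]) leq_add2r card_sqr_roots.
apply: (leq_trans cK).
pose h (k : F) := - (2 * (k * x0 + y0)) / (k ^+ 2 + 1).
have Kn k : k \in K -> k ^+ 2 + 1 != 0 by rewrite !inE addr_eq0.
apply: (leq_card_inj (f := fun k => (x0 + k * h k, y0 + h k))).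
  move=> k /Kn kK; rewrite inE /= -pA; apply/eqP; rewrite /h; field.
  exact: kK.
move=> k k' /Kn kK /Kn kK' [] /addrI e1 /addrI e2.
(* The direction is recovered from the second point of intersection, unless the line is tangent. A
   second tangent direction would force [(x0, y0) = 0] and so [m = 0]. *)
case: (h k =P 0) => [hk0 | /eqP hk0]; last first.
  by apply: (mulIf hk0); rewrite e1 -e2.
have z j : j ^+ 2 + 1 != 0 -> h j = 0 -> j * x0 + y0 = 0.
  move=> jK /eqP; rewrite /h mulf_eq0 invr_eq0 (negPf jK) orbF oppr_eq0 mulf_eq0.
  by rewrite (negPf F2) /= => /eqP.
have e3 := z k kK hk0; have e4 := z k' kK' (etrans (esym e2) hk0).
have : (k - k') * x0 = 0.
  have -> : (k - k') * x0 = (k * x0 + y0) - (k' * x0 + y0) by ring.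
  by rewrite e3 e4 subrr.
move/eqP; rewrite mulf_eq0 subr_eq0 => /orP[/eqP // | /eqP x00].
move: e3 m0; rewrite -pA x00 mulr0 add0r => ->.
by rewrite !expr0n /= addr0 eqxx.
Qed.

End FiniteField.

(** * The quadratic form: hyperplanes, spheres and intersections of spheres *)

Section QuadraticForm.
Set Implicit Arguments.
Unset Strict Implicit.
Variables (F : finFieldType) (d : nat).
Implicit Types (u v w p z : 'rV[F]_d) (s t c : F).

Definition dotv u v : F := \sum_(i < d) u 0 i * v 0 i.

Lemma dotvC u v : dotv u v = dotv v u.
Proof. by apply: eq_bigr => i _; rewrite mulrC. Qed.

Lemma dotvDl u v w : dotv (u + v) w = dotv u w + dotv v w.
Proof. by rewrite -big_split; apply: eq_bigr => i _; rewrite mxE mulrDl. Qed.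

Lemma dotvZl c u v : dotv (c *: u) v = c * dotv u v.
Proof. by rewrite mulr_sumr; apply: eq_bigr => i _; rewrite mxE mulrA. Qed.

Lemma dotvBl u v w : dotv (u - v) w = dotv u w - dotv v w.
Proof. by rewrite dotvDl -scaleN1r dotvZl mulN1r. Qed.

Lemma sqnormE u : sqnorm u = dotv u u.
Proof. by apply: eq_bigr => i _; rewrite expr2. Qed.

Lemma sqnormD u v : sqnorm (u + v) = sqnorm u + 2 * dotv u v + sqnorm v.
Proof. by rewrite !sqnormE !(dotvDl, dotvC _ (u + v)) (dotvC v u); ring. Qed.

Lemma sqnormZ c u : sqnorm (c *: u) = c ^+ 2 * sqnorm u.
Proof. by rewrite !sqnormE dotvZl dotvC dotvZl; ring. Qed.

Lemma sqnormN u : sqnorm (- u) = sqnorm u.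
Proof. by rewrite -scaleN1r sqnormZ sqrrN expr1n mul1r. Qed.

Lemma sqnormB u v : sqnorm (u - v) = sqnorm u - 2 * dotv u v + sqnorm v.
Proof. by rewrite sqnormD sqnormN dotvC -scaleN1r dotvZl dotvC; ring. Qed.

Lemma sqnormBC u v : sqnorm (u - v) = sqnorm (v - u).
Proof. by rewrite -sqnormN opprB. Qed.

(** On the hyperplane, a coordinate at which [w] is nonzero is determined by the others. *)
Lemma card_hyperplane w c : w != 0 ->
  (#|[set y | (dotv w y == c)%R]| <= #|F| ^ (d - 1))%N.
Proof.
move=> w0; have [i wi0] : exists i, w 0 i != 0.
  apply/existsP; apply: contraNT w0; rewrite negb_exists => /forallP w0.
  by apply/eqP/rowP => i; rewrite mxE; apply/eqP; move: (w0 i); rewrite negbK.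
have -> : (d - 1)%N = #|[set~ i]| by rewrite cardsC1 card_ord subn1.
rewrite -cardsT -(card_pffun_on 0) -[leqRHS]cardsE.
apply: (leq_card_inj (f := fun y : 'rV[F]_d => [ffun j => if j == i then 0 else y 0 j])).
  move=> y _; rewrite inE; apply/pffun_onP; split => [|x _]; last by rewrite inE.
  by apply/subsetP => j; rewrite !inE ffunE; case: (j == i); rewrite ?eqxx.
move=> y y'; rewrite !inE => /eqP e /eqP e' /ffunP eqf.
have off j : j != i -> y 0 j = y' 0 j.
  by move=> ji; have := eqf j; rewrite !ffunE (negPf ji).
apply/rowP => j; case: (j =P i) => [-> | /eqP /off //].
apply: (mulfI wi0); move: e'; rewrite -e /dotv (bigD1 i) //= [RHS](bigD1 i) //=.
rewrite (eq_bigr (fun j => w 0 j * y 0 j)) => [/addIr // | k ki].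
by rewrite off.
Qed.

(* Schwartz-Zippel for a quadric [Z] avoiding the point [p] of the flat
   [p + W]: each line through [p] meets [Z] in at most two points. *)
Lemma card_quadric_le (Z W : {set 'rV[F]_d}) p (a b : 'rV[F]_d -> F) c :
  c != 0 ->
  (forall z l, z \in Z -> l *: (z - p) \in W) ->
  (forall v l, p + l *: v \in Z -> c + b v * l + a v * l ^+ 2 = 0) ->
  (#|Z| * #|F| <= 4 * #|W|)%N.
Proof.
move=> c0 ZW Zeq.
have : (#|setX Z [set~ (0 : F)%R]| <= #|W| * 2)%N.
  apply: (leq_card_fibers (f := fun x : 'rV[F]_d * F => x.2 *: (x.1 - p))).
    by move=> [z l]; rewrite !inE /= => /andP[zZ _]; apply: ZW.
  (* For [v = l *: (z - p)] the root along the line is the inverse of [l]. Thus [l] solves the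
     reversed polynomial, whose leading coefficient is [c != 0]. *)
  move=> v _; apply: leq_trans (card_quadratic_roots (a v) (b v) c0).
  apply: (leq_card_inj (f := fun x : 'rV[F]_d * F => x.2)).
    move=> [z l]; rewrite !inE /= => /andP[/andP[zZ l0] /eqP ev].
    have := Zeq v l^-1; rewrite -ev scalerA mulVf // scale1r addrC subrK.
    move=> /(_ zZ) e; apply/eqP; rewrite -[RHS](mulr0 (l ^+ 2)) -e; field.
    exact: l0.
  move=> [z l] [z' l']; rewrite !inE /= => /andP[/andP[zZ l0] /eqP ev].
  move=> /andP[_ /eqP ev'] ell; move: ev'; rewrite -ev -ell.
  by move/(scalerI l0)/addIr => ->.
(* The count reads [#|Z| * (q - 1) <= 2 * #|W|], and [q <= 2 * (q - 1)] turns 2 into 4. *)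
rewrite cardsX cardsC1; have := card_finNzRing_gt1 F.
by move: #|F| #|Z| #|W| => q z w; nia.
Qed.

Lemma card_sphere_le t : (0 < d)%N ->
  (#|[set u : 'rV[F]_d | (sqnorm u == t)%R]| <= 4 * #|F| ^ (d - 1))%N.
Proof.
move=> d0; set Z := [set _ | _].
have q0 : (0 < #|F|)%N by apply: ltnW (card_finNzRing_gt1 F).
rewrite -(leq_pmul2r q0) -mulnA -expnSr subn1 prednK //.
have -> : (#|F| ^ d = #|[set: 'rV[F]_d]|)%N by rewrite cardsT card_mx mul1n.
(* A base point off the sphere: the origin if [t != 0], a unit coordinate vector if [t = 0]. *)
have [p pt] : exists p, sqnorm p - t != 0.
  case: (eqVneq t 0) => [-> | t0]; last first.
    by exists 0; rewrite sqnormE /dotv big1 ?sub0r ?oppr_eq0 // => i _; rewrite mxE mul0r.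
  exists (delta_mx 0 (Ordinal d0)); rewrite subr0 /sqnorm (bigD1 (Ordinal d0)) //=.
  rewrite big1 => [|i ni]; first by rewrite mxE !eqxx expr1n addr0 oner_neq0.
  by rewrite mxE (negPf ni) andbF expr0n.
apply: (@card_quadric_le _ setT p (fun v => sqnorm v) (fun v => 2 * dotv p v) (sqnorm p - t)) => //.
  by move=> z l _; rewrite inE.
move=> v l; rewrite inE sqnormD sqnormZ => /eqP <-.
by rewrite (dotvC p (l *: v)) dotvZl (dotvC v); ring.
Qed.

(** The origin is off the sphere because [t != 0], and closure under scaling keeps the lines from
    the origin inside [U]. *)
Lemma card_sphere_subspace_le (U : {set 'rV[F]_d}) t : (1 < d)%N -> t != 0 ->
  (forall u l, u \in U -> l *: u \in U) -> (#|U| <= #|F| ^ (d - 1))%N ->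
  (#|[set u in U | sqnorm u == t]| <= 4 * #|F| ^ (d - 2))%N.
Proof.
move=> d1 t0 Ulin cU; set Z := [set _ in _ | _].
have q0 : (0 < #|F|)%N by apply: ltnW (card_finNzRing_gt1 F).
rewrite -(leq_pmul2r q0) -mulnA -expnSr.
have -> : (d - 2).+1 = (d - 1)%N by lia.
apply: leq_trans (_ : 4 * #|U| <= _)%N; last by rewrite leq_mul2l cU orbT.
apply: (@card_quadric_le _ _ 0 (fun v => sqnorm v) (fun=> 0) (- t)) => //.
- by rewrite oppr_eq0.
- by move=> z l; rewrite inE subr0 => /andP[zU _]; apply: Ulin.
- by move=> v l; rewrite inE add0r sqnormZ => /andP[_ /eqP <-]; ring.
Qed.

(* [M] collects the vectors from a point to the centres; subtracting the
   equations of two spheres shows that [dotv w (row i M)] is constant on [J]. *)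
Lemma card_common_sphere_le (M : 'M[F]_d) t (J : {set 'I_d}) :
  odd #|F| -> M \in unitmx -> (forall i, sqnorm (row i M) = t) -> J != set0 ->
  (#|[set w | [forall i in J, sqnorm (w - row i M) == t]]|
     <= 4 * #|F| ^ (d - #|J|))%N.
Proof.
move=> oddF Mu Mt /set0Pn[i0 i0J]; have F2 := two_neq0_of_odd_card oddF.
set Z := [set _ | _].
have d0 : (0 < d)%N by apply: leq_ltn_trans (ltn_ord i0).
have q0 : (0 < #|F|)%N by apply: ltnW (card_finNzRing_gt1 F).
rewrite -(leq_pmul2r q0) -mulnA -expnSr.
pose L w i := dotv w (row i M).
have LE w i : (w *m M^T) 0 i = L w i.
  by rewrite mxE; apply: eq_bigr => j _; rewrite !mxE.
have Mtu : M^T \in unitmx by rewrite unitmx_tr.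
(* Since [M] is invertible, the values [L w i] are coordinates of [w]. Hence [W] is a subspace of
   dimension [d - #|J| + 1]. *)
pose W := [set w | [forall i in J, L w i == L w i0]].
have cW : (#|W| <= #|F| ^ (d - #|J|).+1)%N.
  have -> : (d - #|J|).+1 = #|~: (J :\ i0)|.
    have := cardsC (J :\ i0); rewrite card_ord; have := cardsD1 i0 J; rewrite i0J.
    have := max_card J; rewrite card_ord; lia.
  rewrite -cardsT -(card_pffun_on 0) -[leqRHS]cardsE.
  apply: (leq_card_inj (f := fun w => [ffun i => if i \in J :\ i0 then 0 else L w i])).
    move=> y _; rewrite inE; apply/pffun_onP; split => [|x _]; last by rewrite inE.
    by apply/subsetP => j; rewrite !inE ffunE !inE; case: (_ && _); rewrite ?eqxx.
  move=> w w'; rewrite !inE => /forall_inP e /forall_inP e' /ffunP eqf.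
  have eqi0 : L w i0 = L w' i0 by have := eqf i0; rewrite !ffunE !inE eqxx.
  apply: (can_inj (mulmxK Mtu)); apply/rowP => i; rewrite !LE.
  have := eqf i; rewrite !ffunE; case: ifP => // /setD1P[_ iJ] _.
  by rewrite (eqP (e i iJ)) (eqP (e' i iJ)).
have ZE z : z \in Z -> forall i, i \in J -> sqnorm z = 2 * L z i.
  rewrite inE => /forall_inP zZ i iJ; have /eqP := zZ i iJ.
  rewrite sqnormB Mt -/(L z i) => e.
  by apply/eqP; rewrite -subr_eq0; apply/eqP/(addIr t); rewrite add0r.
(* Let [p1] have all coordinates [L p1 i] equal to 1. If [p1] lies on the quadric then
   [sqnorm p1 = 2], and at [- p1] the quadric takes the value 4, which is nonzero. *)
have [p [pc pn]] : exists p, (forall i, L p i = L p i0) /\ sqnorm p - 2 * L p i0 != 0.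
  pose p1 := const_mx 1 *m invmx M^T : 'rV[F]_d.
  have Lp1 i : L p1 i = 1 by rewrite -LE mulmxKV // mxE.
  have LN w i : L (- w) i = - L w i by rewrite /L -scaleN1r dotvZl mulN1r.
  have [e | ] := eqVneq (sqnorm p1 - 2 * L p1 i0) 0; last first.
    by move=> ne; exists p1; split=> [k|]; [rewrite !Lp1 | exact: ne].
  exists (- p1); split=> [k|]; first by rewrite !LN !Lp1.
  move: e; rewrite LN Lp1 sqnormN => /eqP; rewrite subr_eq0 => /eqP ->.
  by have -> : 2 * 1 - 2 * -1 = 2 * 2 :> F; [ring | rewrite mulf_neq0].
apply: leq_trans (_ : 4 * #|W| <= _)%N; last by rewrite leq_mul2l cW orbT.
apply: (@card_quadric_le Z W p (fun v => sqnorm v) (fun v => 2 * dotv p v - 2 * L v i0)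
  (sqnorm p - 2 * L p i0)) => //.
  move=> z l zZ; rewrite inE; apply/forall_inP => i iJ; apply/eqP.
  rewrite /L !dotvZl !dotvBl -/(L p i) -/(L z i) -/(L p i0) -/(L z i0) pc.
  by congr (_ * (_ - _)); apply: (mulfI F2); rewrite -!(ZE z).
move=> v l /ZE /(_ i0 i0J) /eqP; rewrite -subr_eq0 => /eqP <-.
rewrite /L !dotvDl sqnormD sqnormZ (dotvC p (l *: v)) !dotvZl (dotvC v p).
by ring.
Qed.

End QuadraticForm.

(** * Mean square deviation of the degrees via point-hyperplane incidences *)

Section Discrepancy.
Set Implicit Arguments.
Unset Strict Implicit.

Lemma sum_sqr_dev (Y : finType) (N : Y -> nat) (q n : nat) :
  \sum_y (q%:R * (N y)%:R - n%:R) ^+ 2 =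
  q%:R ^+ 2 * (\sum_y N y ^ 2)%N%:R - 2 * q%:R * n%:R * (\sum_y N y)%N%:R
  + #|Y|%:R * n%:R ^+ 2 :> rat.
Proof.
rewrite (eq_bigr (fun y => q%:R ^+ 2 * (N y ^ 2)%N%:R
   + (- (2 * q%:R * n%:R) * (N y)%:R + n%:R ^+ 2))); last first.
  by move=> y _; rewrite natrX; ring.
rewrite !big_split -!mulr_sumr -!natr_sum sumr_const /= mulr_natl.
by rewrite cardT -cardE; ring.
Qed.

Definition degree_in (F : finFieldType) (d : nat) (E : {set 'rV[F]_d}) (t : F)
    (y : 'rV[F]_d) : nat :=
  #|[set x in E | sqnorm (y - x) == t]|.

(* Lifting [y] to the hyperplane [(y, sqnorm y - t)] turns distances into
   incidences, whose second moment is exact because hyperplanes through two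
   points of the paraboloid are equidistributed. *)
Lemma discrepancy_incidence (F : finFieldType) (d : nat) (E : {set 'rV[F]_d})
    (t : F) : odd #|F| -> (0 < d)%N ->
  \sum_y (#|F|%:R * (degree_in E t y)%:R - #|E|%:R) ^+ 2
    <= #|E|%:R * #|F|%:R ^+ (d + 2) :> rat.
Proof.
move=> oddF d0; have F2 := two_neq0_of_odd_card oddF.
set q := #|F|; set n := #|E|.
pose r (x : 'rV[F]_d) (yc : 'rV[F]_d * F) := 2 * dotv x yc.1 - sqnorm x == yc.2.
pose N yc := #|[set x in E | r x yc]|.
have NE y : degree_in E t y = N (y, sqnorm y - t).
  congr (#|pred_of_set _|); apply/setP => x; rewrite !inE /r sqnormB /=; congr (_ && _).
  by rewrite -subr_eq0 -[RHS]subr_eq0 -[RHS]oppr_eq0 dotvC; congr (_ == 0); ring.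
apply: (@le_trans _ _ (\sum_yc (q%:R * (N yc)%:R - n%:R) ^+ 2 : rat)).
  pose G y c : rat := (q%:R * (N (y, c))%:R - n%:R) ^+ 2.
  rewrite (eq_bigr (fun p => G p.1 p.2)) => [|[] //].
  rewrite -(pair_bigA _ G) /=; apply: ler_sum => y _.
  by rewrite NE (bigD1 (sqnorm y - t)) //= lerDl sumr_ge0 // => c _; apply: sqr_ge0.
have card1 x : (#|[set yc | r x yc]| = q ^ d)%N.
  rewrite -[d in RHS]mul1n -card_mx -cardsT.
  rewrite -(card_imset (f := fun y : 'rV[F]_d => (y, 2 * dotv x y - sqnorm x))).
    congr (#|pred_of_set _|); apply/setP => -[y c]; rewrite inE /r /=.
    apply/eqP/imsetP => [<-|[y' _ [-> ->]] //]; by exists y.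
  by move=> y y' [].
have card2 x x' : x' != x -> (#|[set yc | r x yc && r x' yc]| <= q ^ (d - 1))%N.
  (* Subtracting the two incidence equations eliminates [c] and confines [y] to a hyperplane with
     normal [2 *: (x' - x)]; then [y] determines [c]. *)
  rewrite -subr_eq0 => xx'; have w0 : 2 *: (x' - x) != 0 by rewrite scaler_eq0 (negPf F2).
  apply: leq_trans (card_hyperplane (sqnorm x' - sqnorm x) w0).
  apply: (leq_card_inj (f := fst)) => [[y c]|[y c] [y' c']]; rewrite !inE /r /=.
    move=> /andP[/eqP e /eqP e']; rewrite dotvZl dotvBl; apply/eqP.
    have -> : 2 * (dotv x' y - dotv x y) = (2 * dotv x' y - sqnorm x') -
      (2 * dotv x y - sqnorm x) + (sqnorm x' - sqnorm x) by ring.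
    by rewrite e e'; ring.
  by move=> /andP[/eqP <- _] /andP[/eqP <- _] ->.
have eq1 : (\sum_yc N yc = n * q ^ d)%N.
  by rewrite sum_card_rel -sum_nat_const; apply: eq_bigr => x _; apply: card1.
pose S := (\sum_yc N yc ^ 2)%N.
have le2 : (S <= n * (q ^ d + n * q ^ (d - 1)))%N.
  rewrite /S sum_sqr_card_rel -sum_nat_const; apply: leq_sum => x xE.
  rewrite (bigD1 x) //=; apply: leq_add.
    by under eq_finset => yc do rewrite andbb; rewrite card1.
  apply: (@leq_trans (\sum_(x' in E) q ^ (d - 1))%N); last by rewrite sum_nat_const.
  rewrite [leqRHS](bigD1 x) //= -[leqLHS]add0n; apply: leq_add => //.
  by apply: leq_sum => x' /andP[_ x'x]; apply: card2.
rewrite sum_sqr_dev -/S eq1 card_prod card_mx mul1n -/q -/n.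
have := le2; rewrite -(ler_nat rat) => {}le2.
have q0 : 0 <= q%:R ^+ 2 :> rat by apply: sqr_ge0.
have := ler_wpM2l q0 le2.
move: S {le2} => S; have -> : (d + 2 = (d - 1) + 3)%N by lia.
have -> : (q ^ d = q ^ (d - 1) * q)%N by rewrite -expnSr subn1 prednK.
rewrite !(natrM, natrD, natrX) exprD.
have : 0 <= q%:R ^+ (d - 1) :> rat by rewrite exprn_ge0.
have : 0 <= q%:R :> rat by []. have : 0 <= n%:R :> rat by [].
by move: (S%:R : rat) (q%:R ^+ (d - 1) : rat) (q%:R : rat) (n%:R : rat) => T Q a b b0 a0 Q0; nra.
Qed.
End Discrepancy.

(** * Spheres and their pairwise intersections in dimension 3 *)

Section ThreeSpace.
Set Implicit Arguments.
Unset Strict Implicit.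
Variable F : finFieldType.
Hypothesis oddF : odd #|F|.
Let F2 : 2 != 0 :> F := two_neq0_of_odd_card oddF.

(** If all three pairwise sums of squares vanished, so would each square, as 2 is invertible. The
    frame is thus available even for isotropic [z]. *)
Lemma frame3 (z : 'rV[F]_3) : z != 0 ->
  exists i j k : 'I_3, [/\ forall f : 'I_3 -> F, \sum_l f l = f i + f j + f k,
    forall l, [\/ l = i, l = j | l = k] & z 0 i ^+ 2 + z 0 j ^+ 2 != 0].
Proof.
move=> z0; pose o0 : 'I_3 := inord 0; pose o1 : 'I_3 := inord 1; pose o2 : 'I_3 := inord 2.
have cover l : [\/ l = o0, l = o1 | l = o2].
  by case: l => [[|[|[|//]]] ?]; [apply: Or31 | apply: Or32 | apply: Or33];
    apply: val_inj; rewrite /= inordK.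
have sum3 (f : 'I_3 -> F) : \sum_l f l = f o0 + f o1 + f o2.
  rewrite !big_ord_recr /= big_ord0 add0r.
  by congr (f _ + f _ + f _); apply: val_inj; rewrite /= inordK.
have [e01 | ne] := eqVneq (z 0 o0 ^+ 2 + z 0 o1 ^+ 2) 0; last first.
  by exists o0, o1, o2.
have [e02 | ne] := eqVneq (z 0 o0 ^+ 2 + z 0 o2 ^+ 2) 0; last first.
  exists o0, o2, o1; split=> // [f | l]; first by rewrite sum3; ring.
  by case: (cover l) => ->; [apply: Or31 | apply: Or33 | apply: Or32].
have [e12 | ne] := eqVneq (z 0 o1 ^+ 2 + z 0 o2 ^+ 2) 0; last first.
  exists o1, o2, o0; split=> // [f | l]; first by rewrite sum3; ring.
  by case: (cover l) => ->; [apply: Or33 | apply: Or31 | apply: Or32].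
case/eqP: z0; have : 2 * z 0 o0 ^+ 2 = 0.
  have -> : 2 * z 0 o0 ^+ 2 = (z 0 o0 ^+ 2 + z 0 o1 ^+ 2) + (z 0 o0 ^+ 2 + z 0 o2 ^+ 2)
    - (z 0 o1 ^+ 2 + z 0 o2 ^+ 2) by ring.
  by rewrite e01 e02 e12 !addr0 subr0.
move/eqP; rewrite mulf_eq0 (negPf F2) sqrf_eq0 /= => /eqP a0.
move: e01 e02; rewrite a0 expr0n /= !add0r => /eqP; rewrite sqrf_eq0 => /eqP b0.
move/eqP; rewrite sqrf_eq0 => /eqP c0.
by apply/rowP => l; rewrite mxE; case: (cover l) => ->.
Qed.

Definition sphere_cap d (t : F) (z : 'rV[F]_d) : {set 'rV[F]_d} :=
  [set u | (sqnorm u == t) && (sqnorm (u - z) == t)].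

(* Coordinates on the plane [2 * dotv u z = sqnorm z] in which the
   intersection of two spheres becomes a conic. *)
Lemma sphere_cap_conic (t : F) (z : 'rV[F]_3) : z != 0 ->
  exists (n c : F) (g : 'rV[F]_3 -> F * F),
    [/\ n != 0, sqnorm z = n + c ^+ 2,
     forall u, u \in sphere_cap t z -> (g u).1 ^+ 2 + sqnorm z * (g u).2 ^+ 2
       - sqnorm z * c * (g u).2 + sqnorm z ^+ 2 / 4 - n * t = 0
     & {in sphere_cap t z &, injective g}].
Proof.
move=> /frame3[i [j [k [sum3 cover n0]]]].
set a := z 0 i in n0; set b := z 0 j in n0; pose c := z 0 k.
have F4 : 4 != 0 :> F by have -> : 4 = 2 * 2 :> F; [ring | rewrite mulf_neq0].
have capE u : u \in sphere_cap t z -> u 0 i ^+ 2 + u 0 j ^+ 2 + u 0 k ^+ 2 = t /\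
    a * u 0 i + b * u 0 j = sqnorm z / 2 - c * u 0 k.
  rewrite inE => /andP[/eqP e1 /eqP]; rewrite sqnormB e1 => e2.
  split; first by rewrite -e1 /sqnorm sum3.
  have : 2 * dotv u z = sqnorm z.
    by apply/eqP; rewrite -subr_eq0 -oppr_eq0; apply/eqP/(addrI t); rewrite addr0 -{2}e2; ring.
  by move=> <-; rewrite /dotv sum3 -/a -/b -/c; field.
exists (a ^+ 2 + b ^+ 2), c, (fun u => (b * u 0 i - a * u 0 j, u 0 k)).
have sE : sqnorm z = a ^+ 2 + b ^+ 2 + c ^+ 2 by rewrite /sqnorm sum3.
split=> // [u /capE[e1 e2] | u v /capE[_ e1] /capE[_ e2] [e3 e4]] /=.
  (* Lagrange's identity: the squares of [a * u 0 i + b * u 0 j] and [b * u 0 i - a * u 0 j] add up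
     to [a ^ 2 + b ^ 2] times [u 0 i ^ 2 + u 0 j ^ 2]. *)
  have -> : (b * u 0 i - a * u 0 j) ^+ 2 = (a ^+ 2 + b ^+ 2) * (t - u 0 k ^+ 2) -
     (sqnorm z / 2 - c * u 0 k) ^+ 2 by rewrite -e1 -e2; ring.
  by rewrite sE; field; rewrite F2 F4.
have ei : u 0 i = v 0 i.
  apply: (mulfI n0).
  have h (w : 'rV[F]_3) : (a ^+ 2 + b ^+ 2) * w 0 i =
    a * (a * w 0 i + b * w 0 j) + b * (b * w 0 i - a * w 0 j) by ring.
  by rewrite !h e3 e1 e2 e4.
have ej : u 0 j = v 0 j.
  apply: (mulfI n0).
  have h (w : 'rV[F]_3) : (a ^+ 2 + b ^+ 2) * w 0 j =
    b * (a * w 0 i + b * w 0 j) - a * (b * w 0 i - a * w 0 j) by ring.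
  by rewrite !h e3 e1 e2 e4.
by apply/rowP => l; case: (cover l) => ->.
Qed.

(** Once the second conic coordinate is fixed, the square of the first is known. This covers the
    degenerate conics too. *)
Lemma card_sphere_cap_le (t : F) (z : 'rV[F]_3) : z != 0 ->
  (#|sphere_cap t z| <= 2 * #|F|)%N.
Proof.
move=> /(sphere_cap_conic t)[n [c [g [n0 _ gE gi]]]].
rewrite mulnC -cardsT; apply: (leq_card_fibers (f := fun u => (g u).2)).
  by move=> u _; rewrite inE.
move=> w _.
pose h := sqnorm z * w ^+ 2 - sqnorm z * c * w + sqnorm z ^+ 2 / 4 - n * t.
apply: leq_trans (card_sqr_roots (- h)).
apply: (leq_card_inj (f := fun u => (g u).1)) => [u | u v].
  rewrite !inE -addr_eq0 => /andP[uc /eqP uw].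
  have := gE u; rewrite inE uw => /(_ uc) e.
  by apply/eqP; rewrite -e /h; ring.
rewrite !inE => /andP[uc /eqP uw] /andP[vc /eqP vw] e.
apply: gi; rewrite ?inE //.
by move: uw vw e; case: (g u) (g v) => [? ?] [? ?] /= -> -> ->.
Qed.

(** Completing the square, with shift [c / 2], gives the conic [X ^ 2 + s Y ^ 2 = n (t - s / 4)] for
    [s = sqnorm z]; the two hypotheses make it nondegenerate. *)
Lemma card_sphere_cap_generic_le (t : F) (z : 'rV[F]_3) :
  sqnorm z != 0 -> sqnorm z != 4 * t -> (#|sphere_cap t z| <= #|F| + 2)%N.
Proof.
move=> s0 st; have F4 : 4 != 0 :> F by have -> : 4 = 2 * 2 :> F; [ring | rewrite mulf_neq0].
have z0 : z != 0.
  by apply: contraNneq s0 => ->; rewrite sqnormE /dotv big1 // => i _; rewrite mxE mul0r.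
have [n [c [g [n0 sE gE gi]]]] := sphere_cap_conic t z0.
have m0 : n * (t - sqnorm z / 4) != 0.
  rewrite mulf_neq0 // subr_eq0; apply: contraNneq st => ->; apply/eqP; field.
  exact: F4.
apply: leq_trans (card_conic_le oddF s0 m0).
apply: (leq_card_inj (f := fun u => ((g u).1, (g u).2 - c / 2))) => [u uc | u v uc vc].
  have en : n = sqnorm z - c ^+ 2 by rewrite sE addrK.
  rewrite inE /= -subr_eq0; apply/eqP.
  rewrite -[RHS](gE u uc) en; field.
  by rewrite F2 F4.
move=> [e1 /addIr e2]; apply: gi => //.
by move: e1 e2; case: (g u) (g v) => [? ?] [? ?] /= -> ->.
Qed.

(** Slice by the last coordinate [w]: whenever [w ^ 2 != t], the slice is a circle with nonzero
    constant [t - w ^ 2]. *)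
Lemma card_sphere3_ge (t : F) :
  ((#|F| - 2) * (#|F| - 2) <= #|[set u : 'rV[F]_3 | (sqnorm u == t)%R]|)%N.
Proof.
pose B := ~: [set w : F | w ^+ 2 == t].
have cB : (#|F| - 2 <= #|B|)%N.
  by rewrite leq_subLR -(cardsC [set w : F | w ^+ 2 == t]) leq_add2r card_sqr_roots.
apply: leq_trans (leq_mul cB (leqnn _)) _.
apply: (geq_card_fibers (f := fun u : 'rV[F]_3 => u 0 ord_max)) => w.
rewrite !inE -subr_eq0 -oppr_eq0 opprB => /(card_circle_ge oddF) circ.
apply: leq_trans circ _.
apply: (leq_card_inj (f := fun p : F * F => \row_(l < 3) [:: p.1; p.2; w]`_l)).
  move=> [x y]; rewrite !inE /sqnorm /= => /eqP e.
  rewrite !big_ord_recr /= big_ord0 add0r !mxE /= e subrK !eqxx.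
  by [].
move=> [x y] [x' y'] _ _ /rowP e.
by have := e (inord 0); have := e (inord 1); rewrite !mxE !inordK //= => -> ->.
Qed.

End ThreeSpace.

(** * Mean square deviation of the degrees in dimension 3 *)

Section DiscrepancyThree.
Set Implicit Arguments.
Unset Strict Implicit.
Variables (F : finFieldType) (E : {set 'rV[F]_3}).
Hypothesis oddF : odd #|F|.
Let q := #|F|.
Let n := #|E|.

(** Pairs are ordered, and the diagonal is included when [s = 0]. *)
Definition pairs_at (s : F) : nat := (\sum_(y in E) degree_in E s y)%N.

Lemma pairs_atE s :
  pairs_at s = (\sum_(x in E) \sum_(x' in E) (sqnorm (x' - x) == s)%R)%N.
Proof.
apply: eq_bigr => y _; rewrite /degree_in -sum1_card big_mkcond [RHS]big_mkcond /=.
by apply: eq_bigr => x _; rewrite inE sqnormBC; case: (x \in E); case: eqP.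
Qed.

(** Expand into pairs of centres: equal ones share a whole sphere, generic ones at most [q + 2]
    points, exceptional ones at most [2 * q]. *)
Lemma sum_sqr_degree3_le t :
  (\sum_y degree_in E t y ^ 2 <=
   n * (4 * q ^ 2) + n * n * (q + 2)
   + 2 * q * (pairs_at 0%R + pairs_at (4 * t)%R))%N.
Proof.
rewrite (sum_sqr_card_rel E (fun x y => sqnorm (y - x) == t)).
have cap (x x' : 'rV[F]_3) : (#|[set y | (sqnorm (y - x) == t)%R && (sqnorm (y - x') == t)%R]| <=
    (x' == x) * (4 * q ^ 2) + (q + 2) + 2 * q * ((sqnorm (x' - x) == 0)%R
    + (sqnorm (x' - x) == 4 * t)%R))%N.
  apply: (@leq_trans #|sphere_cap t (x' - x)%R|).
    apply: (leq_card_inj (f := fun y => y - x)) => [y | y y' _ _ /addIr //].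
    by rewrite !inE opprB addrA subrK.
  have [-> | x'x] := eqVneq x' x.
    apply: (@leq_trans #|[set u : 'rV[F]_3 | (sqnorm u == t)%R]|).
      by apply: subset_leq_card; apply/subsetP => u; rewrite !inE => /andP[].
    apply: leq_trans (card_sphere_le t (ltn0Sn 2)) _.
    by rewrite mul1n -addnA leq_addr.
  have z0 : x' - x != 0 by rewrite subr_eq0.
  have := card_sphere_cap_le oddF t z0.
  have := @card_sphere_cap_generic_le _ oddF t (x' - x); rewrite -/q.
  by case: eqP => [_|_]; case: eqP => [_|_] //=; [lia | lia | lia | move=> /(_ isT isT); lia].
apply: (@leq_trans (\sum_(x in E) \sum_(x' in E)
   ((x' == x) * (4 * q ^ 2) + (q + 2) + 2 * q * ((sqnorm (x' - x) == 0)%R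
    + (sqnorm (x' - x) == 4 * t)%R)))%N).
  by apply: leq_sum => x _; apply: leq_sum => x' _; apply: cap.
rewrite !pairs_atE -big_split /= big_distrr /= -mulnA -!sum_nat_const -!big_split /=.
apply: leq_sum => x xE; rewrite !big_split /= -!big_distrr -!big_distrl !big_split /=.
rewrite !leq_add2r (bigD1 x) //= eqxx big1 ?mul1n // => x' /andP[_].
by case: eqP.
Qed.

(** The terms in [q ^ 3 n ^ 2] cancel. The 14 collects 2 from the conic bound [q + 2], 8 from the
    deficit [4 q] of the sphere, and 4 from equal centres by [q ^ 2 <= n]. *)
Lemma discrepancy3_le t (M : nat) : (q ^ 2 <= n)%N ->
  (pairs_at 0%R <= M)%N -> (pairs_at (4 * t)%R <= M)%N ->
  \sum_y (q%:R * (degree_in E t y)%:R - n%:R) ^+ 2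
    <= 14 * q%:R ^+ 2 * n%:R ^+ 2 + 4 * q%:R ^+ 3 * M%:R :> rat.
Proof.
move=> qn le0 le4.
have q2 : (1 < q)%N by apply: card_finNzRing_gt1.
pose S := #|[set u : 'rV[F]_3 | sqnorm u == t]|.
have eq1 : (\sum_y degree_in E t y = n * S)%N.
  rewrite (sum_card_rel E (fun x y => sqnorm (y - x) == t)) -sum_nat_const.
  apply: eq_bigr => x _.
  rewrite -(card_imset (f := fun y => y - x)); last exact: addIr.
  congr (#|pred_of_set _|); apply/setP => u; rewrite inE.
  apply/imsetP/eqP => [[y] | <-]; first by rewrite inE => /eqP <- ->.
  by exists (u + x); rewrite ?inE addrK.
have := sum_sqr_degree3_le t; set T := (\sum_y _)%N => leT.
rewrite sum_sqr_dev eq1 -/T card_mx mul1n -/q.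
have leT' : (T <= 4 * n * q ^ 2 + n ^ 2 * (q + 2) + 4 * q * M)%N.
  apply: leq_trans leT _; rewrite -mulnn mulnA (mulnC n) leq_add2l.
  by apply: leq_trans (_ : 2 * q * (M + M) <= _)%N; [rewrite leq_mul2l leq_add ?orbT | lia].
have geS : (q ^ 2 <= S + 4 * q)%N.
  have := card_sphere3_ge oddF t; rewrite -/S -/q => h.
  by move: q2 h; clear; move: q S => a b; nia.
move: S T eq1 leT leT' geS => S T _ _; rewrite -!(ler_nat rat).
move: qn; rewrite -(ler_nat rat) !(natrM, natrD, natrX).
have : 0 <= q%:R :> rat by []. have : 0 <= n%:R :> rat by [].
have : 0 <= M%:R :> rat by []. have : 0 <= S%:R :> rat by [].
move: (q%:R : rat) (n%:R : rat) (M%:R : rat) (S%:R : rat) (T%:R : rat).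
move=> a b m s x s0 m0 b0 a0 ab hx hs.
have h1 : a ^+ 2 * x <= a ^+ 2 * (4 * b * a ^+ 2 + b ^+ 2 * (a + 2) + 4 * a * m).
  by apply: ler_wpM2l hx; apply: sqr_ge0.
have h2 : (2 * a * b ^+ 2) * a ^+ 2 <= (2 * a * b ^+ 2) * (s + 4 * a).
  by apply: ler_wpM2l hs; rewrite !mulr_ge0 ?sqr_ge0.
have h3 : (4 * b * a ^+ 2) * a ^+ 2 <= (4 * b * a ^+ 2) * b.
  by apply: ler_wpM2l ab; rewrite !mulr_ge0 ?sqr_ge0.
lra.
Qed.

Lemma discrepancy3 t : (q ^ 2 <= n)%N ->
  \sum_y (q%:R * (degree_in E t y)%:R - n%:R) ^+ 2
    <= 46 * q%:R ^+ 2 * n%:R ^+ 2 :> rat.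
Proof.
move=> qn; have q2 : (1 < q)%N by apply: card_finNzRing_gt1.
have n0 : 0 < n%:R :> rat by rewrite ltr0n; apply: leq_trans qn; rewrite expn_gt0; lia.
pose M := (\max_s pairs_at s)%N.
have leM s : (pairs_at s <= M)%N by apply: leq_bigmax.
have [s Ms] : exists s, M = pairs_at s by have [|s es] := @bigop.eq_bigmax F pairs_at; [exact: ltnW | exists s].
(* The largest number of pairs at a common distance is controlled by the
   discrepancy, which is itself controlled by that number. *)
have P8 : q%:R * M%:R <= 8 * n%:R ^+ 2 :> rat.
  have D := discrepancy3_le qn (leM 0) (leM (4 * s)).
  pose a y : rat := q%:R * (degree_in E s y)%:R - n%:R.
  have sumE : \sum_(y in E) a y = q%:R * M%:R - n%:R ^+ 2.
    rewrite big_split /= -mulr_sumr -natr_sum sumr_const -/n Ms /pairs_at; congr (_ + _).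
    by rewrite -[LHS]mulr_natl mulrN expr2.
  (* This sums [(a y - 7 n) ^ 2 >= 0]. Combined with [D] and [q ^ 2 <= n], the weight 7 leads to
     [10 n (q M) <= 77 n ^ 3]. *)
  have AMGM : 14 * n%:R * (q%:R * M%:R - n%:R ^+ 2) <= \sum_y a y ^+ 2 + 49 * n%:R ^+ 3.
    apply: (@le_trans _ _ (\sum_(y in E) (a y ^+ 2 + 49 * n%:R ^+ 2))).
      rewrite -sumE mulr_sumr; apply: ler_sum => y _.
      rewrite -subr_ge0; have -> : a y ^+ 2 + 49 * n%:R ^+ 2 - 14 * n%:R * a y
        = (a y - 7 * n%:R) ^+ 2 by ring.
      exact: sqr_ge0.
    rewrite big_split /= sumr_const -/n; apply: lerD.
      by rewrite [leRHS](bigID (mem E)) /= lerDl sumr_ge0 // => y _; apply: sqr_ge0.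
    by rewrite -mulr_natr; lra.
  have {}D : \sum_y a y ^+ 2 <= 14 * q%:R ^+ 2 * n%:R ^+ 2 + 4 * q%:R ^+ 3 * M%:R by [].
  move: AMGM D n0; move: (\sum_y _) => S.
  have : 0 <= q%:R * M%:R :> rat by apply: mulr_ge0.
  move: qn; rewrite -(ler_nat rat) natrX.
  move: (q%:R : rat) (n%:R : rat) (M%:R : rat) => x y m xy xm A D y0.
  have h1 : (14 * y ^+ 2 + 4 * (x * m)) * x ^+ 2 <= (14 * y ^+ 2 + 4 * (x * m)) * y.
    by apply: ler_wpM2l xy; nra.
  have h2 : y * (x * m) <= y * (8 * y ^+ 2) by nra.
  by rewrite ler_pM2l in h2.
(* Here 46 is [14 + 4 * 8]. *)
apply: le_trans (discrepancy3_le qn (leM 0) (leM (4 * t))) _.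
have : 0 <= q%:R ^+ 2 * 4 :> rat by rewrite mulr_ge0 ?sqr_ge0.
by move/ler_wpM2l => /(_ _ _ P8); lra.
Qed.

End DiscrepancyThree.

(** * A common bound for the deviation in all dimensions at least 3 *)

Section DiscrepancyAll.

(** The constant 368 is [8 * 46], for dimension 3. From dimension 4 on, [d + 2 <= 2 * (d - 1)] makes
    the incidence bound small enough. *)
Lemma discrepancy_small (F : finFieldType) (d : nat) (E : {set 'rV[F]_d})
    (t : F) (c : nat) : odd #|F| -> (3 <= d)%N -> 368 <= c%:R :> rat ->
    (c * #|F| ^ (d - 1) <= #|E|)%N ->
  8 * \sum_y (#|F|%:R * (degree_in E t y)%:R - #|E|%:R) ^+ 2
    <= #|E|%:R ^+ 3 :> rat.
Proof.
move=> oddF d3 c368; have q2 := card_finNzRing_gt1 F.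
have c8 : (8 <= c)%N by rewrite -(ler_nat rat); apply: le_trans c368; lra.
rewrite leq_eqVlt in d3; case/orP: d3 => [/eqP d3 | d4].
  subst d; have -> : (3 - 1 = 2)%N by [].
  move=> nE.
  have qn : (#|F| ^ 2 <= #|E|)%N.
    by apply: leq_trans nE; apply: leq_pmull; apply: leq_trans c8.
  have := discrepancy3 oddF t qn; move: (\sum_y _) => S.
  move: nE; rewrite -(ler_nat rat) natrM natrX.
  have : 0 <= #|E|%:R :> rat by [].
  move: (#|F|%:R : rat) (#|E|%:R : rat) => a b b0 ab hS.
  have h : b ^+ 2 * (c%:R * a ^+ 2) <= b ^+ 2 * b by apply: ler_wpM2l ab; apply: sqr_ge0.
  have ab0 : 0 <= a ^+ 2 * b ^+ 2 by rewrite mulr_ge0 ?sqr_ge0.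
  have := ler_wpM2l ab0 c368; lra.
move=> nE; have := @discrepancy_incidence F d E t oddF (ltn_trans (isT : 0 < 3)%N d4).
have h : (8 * #|F| ^ (d + 2) <= #|E| ^ 2)%N.
  have hp : (#|F| ^ (d + 2) <= (#|F| ^ (d - 1)) ^ 2)%N.
    by rewrite -expnM leq_pexp2l; lia.
  have {}nE : (8 * #|F| ^ (d - 1) <= #|E|)%N by apply: leq_trans nE; rewrite leq_mul2r c8 orbT.
  apply: leq_trans (_ : (8 * #|F| ^ (d - 1)) ^ 2 <= _)%N; last by rewrite leq_exp2r.
  by rewrite expnMn; apply: leq_mul.
move: (\sum_y _) => S hS.
move: h; rewrite -(ler_nat rat) natrM !natrX => h.
have := ler_wpM2l (ler0n rat #|E|) h; lra.
Qed.

End DiscrepancyAll.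

(** * Centres of typical degree and the number of stars *)

Section Stars.
Set Implicit Arguments.
Unset Strict Implicit.

Lemma leq_card_bigcup (T I : finType) (A : {pred I}) (B : I -> {set T}) :
  (#|\bigcup_(i in A) B i| <= \sum_(i in A) #|B i|)%N.
Proof.
elim/big_ind2: _ => [|x m y p xm yp|//]; first by rewrite cards0.
by apply: leq_trans (leq_add xm yp); apply: leq_card_setU.
Qed.

(** A row with nonzero coefficient in a linear dependency lies in the span of the others. Degenerate
    stars can thus be counted by their redundant leaf. *)
Lemma singular_row_sub (F : fieldType) (d : nat) (M : 'M[F]_d) :
  M \notin unitmx -> exists j, (row j M <= row' j M)%MS.
Proof.
rewrite unitmxE unitfE negbK => /det0P[v v0 vM].
have [j vj] : exists j, v 0 j != 0.
  apply/existsP; apply: contraNT v0; rewrite negb_exists => /forallP v0.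
  by apply/eqP/rowP => i; rewrite mxE; apply/eqP; move: (v0 i); rewrite negbK.
exists j; rewrite -(eqmx_scale _ vj).
move: vM; rewrite mulmx_sum_row (bigD1 j) //= => /eqP; rewrite addr_eq0 => /eqP ->.
rewrite eqmx_opp; apply: summx_sub => i ij; apply: scalemx_sub.
have [k ->] : exists k, i = lift j k.
  by case: (unliftP j i) ij => [k -> _|->]; [exists k | rewrite eqxx].
have -> : row (lift j k) M = row k (row' j M) by apply/rowP => l; rewrite !mxE.
exact: row_sub.
Qed.

Variables (F : finFieldType) (d : nat) (t : F) (E : {set 'rV[F]_d}).
Let q := #|F|.
Let n := #|E|.

Definition nbhd (y : 'rV[F]_d) : {set 'rV[F]_d} :=
  [set x in E | sqnorm (y - x) == t].

(** The degree differs from the mean [n / q] by at most half of it. *)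
Definition good_centres : {set 'rV[F]_d} :=
  [set y in E | (n <= 2 * q * #|nbhd y|)%N && (2 * q * #|nbhd y| <= 3 * n)%N].

(** Chebyshev: each other point of [E] contributes at least [n ^ 2 / 4] to a sum of at most
    [n ^ 3 / 8]. *)
Lemma card_good_centres (c : nat) : odd q -> (3 <= d)%N ->
  368 <= c%:R :> rat -> (c * q ^ (d - 1) <= n)%N ->
  (n <= 2 * #|good_centres|)%N.
Proof.
move=> oddF d3 c368 nE; have D := @discrepancy_small F d E t c oddF d3 c368 nE.
have n0 : (0 < n)%N.
  apply: leq_trans nE; rewrite muln_gt0 expn_gt0 (ltnW (card_finNzRing_gt1 F)) orTb andbT.
  apply: (@leq_trans 8); first by [].
  by rewrite -(ler_nat rat); apply: le_trans c368; lra.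
clear c368 nE; pose B := E :\: good_centres.
have cE : (n = #|good_centres| + #|B|)%N.
  rewrite /n -(cardsID good_centres E); congr (_ + _)%N; congr (#|pred_of_set _|).
  by apply/setIidPr/subsetP => y; rewrite inE => /andP[].
have : #|B|%:R * n%:R ^+ 2 <= 4 * \sum_y (q%:R * (degree_in E t y)%:R - n%:R) ^+ 2 :> rat.
  rewrite mulr_sumr (bigID (mem B)) /= mulr_natl -sumr_const -[leLHS]addr0.
  apply: lerD; last by apply: sumr_ge0 => y _; rewrite mulr_ge0 ?sqr_ge0.
  apply: ler_sum => y; rewrite !inE -/(degree_in E t y) => /andP[yG yE].
  move: yG; rewrite yE /= negb_and -!ltnNge.
  rewrite -!(ltr_nat rat) !natrM.
  have : 0 <= q%:R * (degree_in E t y)%:R :> rat by rewrite mulr_ge0.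
  have : 0 <= n%:R :> rat by [].
  move: (q%:R : rat) (n%:R : rat) ((degree_in E t y)%:R : rat) => a b e b0 ae.
  by case/orP => h; nra.
move: D; rewrite -/q -/n; move: (\sum_y _) => S hS hB.
have {hS hB} : 2 * (#|B|%:R * n%:R ^+ 2) <= n%:R * n%:R ^+ 2 :> rat.
  by rewrite -exprS; lra.
rewrite mulrA ler_pM2r; last by rewrite exprn_gt0 // ltr0n.
by rewrite -natrM ler_nat cE; lia.
Qed.

(** An apex with an ordered tuple of leaves, which may coincide. *)
Definition star := ('rV[F]_d * {ffun 'I_d -> 'rV[F]_d})%type.

Definition stars : {set star} :=
  [set p : star | (p.1 \in good_centres) && [forall i, p.2 i \in nbhd p.1]].

(** There are at least [n / 2] apexes, each with at least [(n / (2 q)) ^ d] tuples of leaves. *)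
Lemma card_stars : (n <= 2 * #|good_centres|)%N ->
  (n ^ d.+1 <= 2 * (#|stars| * (2 * q) ^ d))%N.
Proof.
move=> nG.
have cS : #|stars| = (\sum_(y in good_centres) #|nbhd y| ^ d)%N.
  rewrite (card_fibers (f := fst) (B := good_centres)); last first.
    by move=> p; rewrite inE => /andP[].
  apply: eq_bigr => y yG.
  have -> : (#|nbhd y| ^ d = #|[set x : {ffun 'I_d -> _} | x \in ffun_on (nbhd y)]|)%N.
    have := @card_ffun_on 'I_d _ (nbhd y); rewrite card_ord => <-.
    by apply: eq_card => x; rewrite [RHS]inE.
  rewrite -[RHS](card_imset (f := fun x => (y, x))); last by move=> x x' [].
  congr (#|pred_of_set _|); apply/setP => -[y' x]; rewrite inE [X in X && _]inE /=.
  apply/andP/imsetP => [[/andP[_ /forallP h] /eqP ey]|[x' x'on [-> ->]]].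
    exists x; last by rewrite ey.
    by rewrite inE; apply/ffun_onP => i; rewrite -ey; apply: h.
  by rewrite yG eqxx; split=> //; apply/forallP/ffun_onP; rewrite inE in x'on.
rewrite cS big_distrl /= expnS.
apply: (@leq_trans (2 * (#|good_centres| * n ^ d))%N).
  by rewrite mulnA leq_mul2r nG orbT.
rewrite leq_mul2l -sum_nat_const; apply/orP; right; apply: leq_sum => y.
rewrite inE -expnMn mulnC => /and3P[_ + _]; move: #|nbhd y| => m nm.
by case: (posnP d) => [-> | d0]; rewrite ?expn0 ?leq_exp2r.
Qed.
End Stars.

(** * Stars with few common neighbours or dependent leaves are rare *)

Section BadStars.
Set Implicit Arguments.
Unset Strict Implicit.
Variables (F : finFieldType) (d : nat) (t : F) (E : {set 'rV[F]_d}).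
Let q := #|F|.
Let n := #|E|.
Let D := (3 * n %/ (2 * q))%N.
Local Notation nbhd := (nbhd t E).
Local Notation good := (good_centres t E).
Local Notation stars := (stars t E).

Let q_gt0 : (0 < q)%N.
Proof. exact: ltnW (card_finNzRing_gt1 F). Qed.

Let degree_le y : y \in good -> (#|nbhd y| <= D)%N.
Proof.
by rewrite inE => /and3P[_ _ h]; rewrite leq_divRL ?muln_gt0 // mulnC.
Qed.

Let leD : (2 * q * D <= 3 * n)%N.
Proof. by rewrite mulnC leq_trunc_div. Qed.

Definition common_nbhd (x : {ffun 'I_d -> 'rV[F]_d}) (I : {set 'I_d}) :
  {set 'rV[F]_d} := [set y in E | [forall i in I, sqnorm (y - x i) == t]].

(** The default 0 outside [I] fits [pffun_on 0 I], which has one free value for each index in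
    [I]. *)
Definition restrict (I : {set 'I_d}) (x : {ffun 'I_d -> 'rV[F]_d}) :
  {ffun 'I_d -> 'rV[F]_d} := [ffun i => if i \in I then x i else 0].

Lemma restrict_pffun (I : {set 'I_d}) (A : {set 'rV[F]_d})
    (x : {ffun 'I_d -> 'rV[F]_d}) : (forall i, i \in I -> x i \in A) ->
  restrict I x \in pffun_on 0 I A.
Proof.
move=> xA; apply/pffun_onP; split=> [|y].
  by apply/subsetP => i; rewrite !inE ffunE; case: (i \in I); rewrite ?eqxx.
by case/imageP => i iI ->; rewrite ffunE iI xA.
Qed.

Lemma restrict_inj (I : {set 'I_d}) x x' :
  restrict I x = restrict I x' -> restrict (~: I) x = restrict (~: I) x' -> x = x'.
Proof.
move=> /ffunP e /ffunP e'; apply/ffunP => i; move: (e i) (e' i).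
by rewrite !ffunE inE; case: (i \in I).
Qed.

Lemma eq_common_nbhd (I : {set 'I_d}) x x' :
  restrict I x = restrict I x' -> common_nbhd x I = common_nbhd x' I.
Proof.
move=> /ffunP e; apply/setP => y; rewrite !inE; congr (_ && _).
apply: eq_forallb_in => i iI.
by have := e i; rewrite !ffunE iI => ->.
Qed.

(** Choose the leaves in [I] freely in [E], then the apex among their at most [b] common neighbours,
    then the other leaves among the at most [D] neighbours of the apex. *)
Lemma card_poor_stars (I : {set 'I_d}) (b : nat) :
  (#|[set p in stars | #|common_nbhd p.2 I| <= b]|
     <= n ^ #|I| * (b * D ^ (d - #|I|)))%N.
Proof.
set P := [set _ in _ | _].
rewrite -(card_pffun_set 0).
apply: (leq_card_fibers (f := fun p => restrict I p.2)) => [p | g _].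
  rewrite !inE => /andP[/andP[_ /forallP h] _]; apply: restrict_pffun => i _.
  by have := h i; rewrite inE => /andP[].
have [-> | [p0]] := set_0Vmem [set x in P | restrict I x.2 == g]; first by rewrite cards0.
rewrite inE => /andP[]; rewrite inE => /andP[_ p0b] /eqP p0g.
apply: leq_trans (_ : #|common_nbhd p0.2 I| * D ^ (d - #|I|) <= _)%N; last first.
  by rewrite leq_mul2r p0b orbT.
apply: (leq_card_fibers (f := fst)) => [p | y _].
  rewrite inE => /andP[]; rewrite inE => /andP[pS _] /eqP pg.
  rewrite (eq_common_nbhd (x' := p.2)) ?p0g //; move: pS; rewrite !inE.
  case/andP => /andP[-> _] /forallP h; apply/forall_inP => i _.
  by have := h i; rewrite inE => /andP[_].
set S := [set _ in _ | _]; have [-> | [p1]] := set_0Vmem S; first by rewrite cards0.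
rewrite !inE => /andP[/andP[/andP[/andP[yG _] _] _] /eqP p1y].
have yG' : y \in good by rewrite -p1y inE.
have -> : (d - #|I| = #|~: I|)%N by rewrite [RHS]cardsCs setCK card_ord.
apply: leq_trans (leq_expl _ (degree_le yG')).
rewrite -(card_pffun_set 0).
apply: (leq_card_inj (f := fun p => restrict (~: I) p.2)) => [p | p p'].
  rewrite inE => /andP[]; rewrite inE => /andP[]; rewrite inE => /andP[pS _] _ /eqP py.
  rewrite inE; apply: restrict_pffun => i _.
  by move: pS; rewrite inE py => /andP[_ /forallP].
rewrite inE => /andP[]; rewrite inE => /andP[_ /eqP pg] /eqP py.
rewrite inE => /andP[]; rewrite inE => /andP[_ /eqP pg'] /eqP py' e.
by apply: injective_projections; [rewrite py | apply: restrict_inj e; rewrite pg].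
Qed.

Definition leaf_mx (y : 'rV[F]_d) (x : {ffun 'I_d -> 'rV[F]_d}) : 'M[F]_d :=
  \matrix_(i < d) (x i - y).

(** Choose the apex and all leaves but [j]. The vector to leaf [j] then lies on a sphere in the span
    of [d - 1] known vectors. *)
Lemma card_degenerate_stars (j : 'I_d) : (1 < d)%N -> t != 0 ->
  (#|[set p in stars | (row j (leaf_mx p.1 p.2) <= row' j (leaf_mx p.1 p.2))%MS]|
     <= n * (D ^ (d - 1) * (4 * q ^ (d - 2))))%N.
Proof.
move=> d1 t0; set P := [set _ in _ | _].
apply: (leq_card_fibers (f := fst)) => [p | y _].
  by rewrite inE => /andP[]; rewrite inE => /andP[]; rewrite inE => /andP[].
set Py := [set _ in _ | _]; have [-> | [p1]] := set_0Vmem Py; first by rewrite cards0.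
rewrite !inE => /andP[/andP[/andP[yG _] _] /eqP p1y].
have yG' : y \in good by rewrite -p1y inE.
have PyE p : p \in Py -> [/\ p.1 = y, forall i, p.2 i \in nbhd y
    & (row j (leaf_mx y p.2) <= row' j (leaf_mx y p.2))%MS].
  rewrite inE => /andP[]; rewrite inE => /andP[pS pj] /eqP py; rewrite -py.
  by split=> //; move: pS; rewrite inE => /andP[_ /forallP].
have -> : (d - 1 = #|[set~ j]|)%N by rewrite cardsC1 card_ord subn1.
apply: leq_trans (leq_mul (leq_expl _ (degree_le yG')) (leqnn _)).
rewrite -(card_pffun_set 0).
apply: (leq_card_fibers (f := fun p => restrict [set~ j] p.2)) => [p | g _].
  by case/PyE => _ h _; rewrite inE; apply: restrict_pffun.
set Pg := [set _ in _ | _]; have [-> | [p0]] := set_0Vmem Pg; first by rewrite cards0.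
rewrite inE => /andP[_ /eqP p0g].
pose U := [set v *m row' j (leaf_mx y p0.2) | v : 'rV[F]_(d.-1)].
have Ulin u l : u \in U -> l *: u \in U.
  by case/imsetP => v _ ->; apply/imsetP; exists (l *: v); rewrite ?scalemxAl.
have cU : (#|U| <= q ^ (d - 1))%N.
  by apply: leq_trans (leq_imset_card _ _) _; rewrite card_mx mul1n subn1.
apply: leq_trans (card_sphere_subspace_le d1 t0 Ulin cU).
apply: (leq_card_inj (f := fun p : star F d => p.2 j - y)) => [p | p p'].
  rewrite inE => /andP[/PyE[_ h pj] /eqP pg].
  have := h j; rewrite inE sqnormBC => /andP[_ pt]; rewrite inE pt andbT.
  have e : row' j (leaf_mx y p.2) = row' j (leaf_mx y p0.2).
    apply/row_matrixP => i; apply/rowP => l; rewrite !mxE.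
    have /ffunP/(_ (lift j i)) : restrict [set~ j] p.2 = restrict [set~ j] p0.2 by rewrite pg.
    by rewrite !ffunE !inE eq_sym neq_lift => ->.
  move: pj; rewrite e => /submxP[v ev].
  by apply/imsetP; exists v => //; rewrite -ev rowK.
rewrite inE => /andP[/PyE[py _ _] /eqP pg]; rewrite inE => /andP[/PyE[py' _ _] /eqP pg'].
move/addIr => ej; apply: injective_projections; first by rewrite py.
apply: (@restrict_inj [set~ j]); first by rewrite pg.
by apply/ffunP => i; rewrite !ffunE !inE negbK; case: eqP => // ->.
Qed.

(** A union bound over at most [2 ^ d] sets [I] and [d] indices [j]. In [16 = 2 * (5 + 3)] the 5
    pays for poor stars, the 3 for degenerate ones, and the 2 comes from [card_stars]; [6 ^ d] is
    [2 ^ d * 3 ^ d]. *)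
Lemma exists_rich_star : (3 <= d)%N -> t != 0 ->
  (n <= 2 * #|good|)%N -> (16 * d * 6 ^ d * q ^ (d - 1) < n)%N ->
  exists2 p, p \in stars & leaf_mx p.1 p.2 \in unitmx /\
    forall I : {set 'I_d}, (#|I| < d)%N ->
      (5 * d * q ^ (d - 1 - #|I|) < #|common_nbhd p.2 I|)%N.
Proof.
move=> d3 t0 nG nE; have dS : (d = (d - 1).+1)%N by clear -d3; lia.
pose bad I := [set p in stars | #|common_nbhd p.2 I| <= 5 * d * q ^ (d - 1 - #|I|)]%N.
pose deg j := [set p in stars | (row j (leaf_mx p.1 p.2) <= row' j (leaf_mx p.1 p.2))%MS].
pose all_bad := (\bigcup_(I in [pred I : {set 'I_d} | (#|I| < d)%N]) bad I) :|:
  (\bigcup_(j in 'I_d) deg j).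
suff [p pS pn] : exists2 p, p \in stars & p \notin all_bad.
  exists p => //; move: pn; rewrite inE negb_or => /andP[pI pj]; split.
    apply: contraT => /singular_row_sub[j js]; case/negP: pj.
    by apply/bigcupP; exists j => //; rewrite inE pS.
  move=> I Id; rewrite ltnNge; apply/negP => h; case/negP: pI.
  by apply/bigcupP; exists I => //; rewrite inE pS.
apply/exists_inP; apply: contraLR nE; rewrite negb_exists_in => /forall_inP h.
rewrite -leqNgt.
have Q : (q ^ (d - 1) = q * q ^ (d - 2))%N by rewrite -expnS; congr (_ ^ _)%N; lia.
have sub : (#|stars| <= #|all_bad|)%N.
  by apply/subset_leq_card/subsetP => p /h; rewrite negbK.
have badI (I : {set 'I_d}) : (#|I| < d)%N ->
    (#|bad I| * (2 * q) ^ d <= 5 * d * 3 ^ d * (n ^ d * q ^ (d - 1)))%N.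
  move=> Id; apply: leq_trans (leq_mul (card_poor_stars I _) (leqnn _)) _.
  move: #|I| Id => k kd; set e := (d - k)%N.
  have kd1 : (k <= d - 1)%N by rewrite -ltnS -dS.
  have De : ((2 * q * D) ^ e <= (3 * n) ^ e)%N by apply: leq_expl.
  have X2 : ((2 * q) ^ d = 2 ^ k * q ^ k * (2 * q) ^ e)%N.
    by rewrite -expnMn -expnD /e subnKC // ltnW.
  have X3 : (3 ^ d = 3 ^ k * 3 ^ e)%N by rewrite -expnD /e subnKC // ltnW.
  have Xn : (n ^ d = n ^ k * n ^ e)%N by rewrite -expnD /e subnKC // ltnW.
  have Xq : (q ^ (d - 1) = q ^ (d - 1 - k) * q ^ k)%N by rewrite -expnD subnK.
  have -> : (n ^ k * (5 * d * q ^ (d - 1 - k) * D ^ e) * (2 * q) ^ d =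
      5 * d * (2 ^ k * (2 * q * D) ^ e) * (n ^ k * q ^ (d - 1)))%N.
    by rewrite X2 Xq !expnMn; ring.
  have -> : (5 * d * 3 ^ d * (n ^ d * q ^ (d - 1)) =
      5 * d * (3 ^ k * (3 * n) ^ e) * (n ^ k * q ^ (d - 1)))%N.
    by rewrite X3 Xn !expnMn; ring.
  by rewrite leq_mul2r leq_mul2l (leq_mul (leq_expl k (leqnSn 2)) De) !orbT.
have degj j : (#|deg j| * (2 * q) ^ d <= 3 * 3 ^ d * (n ^ d * q ^ (d - 1)))%N.
  apply: leq_trans (leq_mul (card_degenerate_stars j _ t0) (leqnn _)) _; first by lia.
  have De : ((2 * q * D) ^ (d - 1) <= (3 * n) ^ (d - 1))%N by apply: leq_expl.
  have Xd a : (a ^ d = a * a ^ (d - 1))%N by rewrite -expnS -dS.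
  have -> : (n * (D ^ (d - 1) * (4 * q ^ (d - 2))) * (2 * q) ^ d =
      8 * (2 * q * D) ^ (d - 1) * (n * q ^ (d - 1)))%N.
    by rewrite (Xd (2 * q)%N) Q !expnMn; ring.
  have -> : (3 * 3 ^ d * (n ^ d * q ^ (d - 1)) =
      9 * (3 * n) ^ (d - 1) * (n * q ^ (d - 1)))%N.
    by rewrite !Xd !expnMn; ring.
  by rewrite leq_mul2r (leq_mul (leqnSn 8) De) orbT.
have sum_bad : (#|stars| * (2 * q) ^ d <= 8 * d * 6 ^ d * (n ^ d * q ^ (d - 1)))%N.
  apply: leq_trans (leq_mul (leq_trans sub (leq_card_setU _ _)) (leqnn _)) _.
  rewrite mulnDl; set X := (n ^ d * q ^ (d - 1))%N in badI degj *.
  apply: (@leq_trans (2 ^ d * (5 * d * 3 ^ d * X) + d * (3 * 3 ^ d * X)))%N.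
    apply: leq_add.
      apply: leq_trans (leq_mul (leq_card_bigcup _ _) (leqnn _)) _; rewrite big_distrl /=.
      apply: (@leq_trans (\sum_(I in [pred I : {set 'I_d} | (#|I| < d)%N])
        (5 * d * 3 ^ d * X)))%N; first by apply: leq_sum => I; apply: badI.
      rewrite sum_nat_const leq_mul2r; apply/orP; right.
      by apply: leq_trans (max_card _) _; rewrite -cardsT -powersetT card_powerset cardsT card_ord.
    apply: leq_trans (leq_mul (leq_card_bigcup _ _) (leqnn _)) _; rewrite big_distrl /=.
    apply: (@leq_trans (\sum_(j in 'I_d) (3 * 3 ^ d * X)))%N.
      by apply: leq_sum => j _; apply: degj.
    by rewrite sum_nat_const card_ord.
  have -> : (6 ^ d = 2 ^ d * 3 ^ d)%N by rewrite -expnMn.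
  have -> : (8 * d * (2 ^ d * 3 ^ d) * X = 2 ^ d * (5 * d * 3 ^ d * X) +
     d * (3 * (2 ^ d * 3 ^ d) * X))%N by ring.
  rewrite leq_add2l leq_mul2l leq_mul2r leq_mul2l leq_pmull ?expn_gt0 //.
  by rewrite !orbT.
have := leq_trans (card_stars nG) (leq_mul (leqnn 2) sum_bad).
rewrite expnS; have [-> // | n0] := posnP n.
have -> : (2 * (8 * d * 6 ^ d * (n ^ d * q ^ (d - 1))) =
  16 * d * 6 ^ d * q ^ (d - 1) * n ^ d)%N by ring.
by rewrite leq_pmul2r // expn_gt0 n0.
Qed.
End BadStars.

(** * The leaves of a rich star are shattered *)

Section Shattering.
Set Implicit Arguments.
Unset Strict Implicit.
Variables (F : finFieldType) (d : nat) (t : F) (E : {set 'rV[F]_d}).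

Lemma card_common_nbhd_le y (x : {ffun 'I_d -> 'rV[F]_d}) (J : {set 'I_d}) :
  odd #|F| -> leaf_mx y x \in unitmx -> (forall i, sqnorm (y - x i) = t) ->
  J != set0 -> (#|common_nbhd t E x J| <= 4 * #|F| ^ (d - #|J|))%N.
Proof.
move=> oddF Mu xt J0.
have rowE i : row i (leaf_mx y x) = x i - y by rewrite rowK.
apply: leq_trans (card_common_sphere_le oddF Mu _ J0); last first.
  by move=> i; rewrite rowE sqnormBC; apply: xt.
apply: (leq_card_inj (f := fun z => z - y)) => [z | z z' _ _ /addIr //].
rewrite !inE => /andP[_ /forall_inP h]; apply/forall_inP => i iJ.
by rewrite rowE opprB addrA subrK; apply: h.
Qed.

(** For [I] full, [y] itself serves. Otherwise the common neighbours of [I] outnumber those that are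
    also adjacent or equal to a further leaf. *)
Lemma rich_star_separates y (x : {ffun 'I_d -> 'rV[F]_d}) :
  odd #|F| -> t != 0 -> y \in E -> (forall i, x i \in E) ->
  (forall i, sqnorm (y - x i) = t) -> leaf_mx y x \in unitmx ->
  (forall I : {set 'I_d}, (#|I| < d)%N ->
    (5 * d * #|F| ^ (d - 1 - #|I|) < #|common_nbhd t E x I|)%N) ->
  forall I : {set 'I_d}, exists2 z, z \in E &
    forall i, (z == x i) || (sqnorm (z - x i) == t) = (i \in I).
Proof.
move=> oddF t0 yE xE xt Mu rich I.
have sqn0 : sqnorm (0 : 'rV[F]_d) = 0.
  by rewrite sqnormE /dotv big1 // => i _; rewrite mxE mul0r.
have [Id | Id] := ltnP #|I| d; last first.
  have -> : I = setT by apply/eqP; rewrite eqEcard subsetT cardsT card_ord Id.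
  by exists y => // i; rewrite xt eqxx orbT inE.
(* The singletons are removed because a leaf belongs to its own closed neighborhood. Each [j] costs
   [4 + 1] times the power of [q]. *)
pose bad := \bigcup_(j in ~: I) (common_nbhd t E x (j |: I) :|: [set x j]).
have cbad : (#|bad| <= 5 * d * #|F| ^ (d - 1 - #|I|))%N.
  apply: leq_trans (leq_card_bigcup _ _) _.
  apply: (@leq_trans (\sum_(j in ~: I) 5 * #|F| ^ (d - 1 - #|I|))%N).
    apply: leq_sum => j; rewrite inE => jI.
    apply: leq_trans (leq_card_setU _ _) _; rewrite cards1 mulSn addnC.
    apply: leq_add; first by rewrite expn_gt0 (ltnW (card_finNzRing_gt1 F)).
    apply: leq_trans (card_common_nbhd_le oddF Mu xt _) _.
      by apply/set0Pn; exists j; rewrite setU11.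
    by rewrite cardsU1 jI /= subnDA.
  rewrite sum_nat_const mulnA (mulnC _ 5) leq_mul2r leq_mul2l.
  by rewrite (leq_trans (max_card _)) ?card_ord ?orbT.
have /set0Pn[z] : common_nbhd t E x I :\: bad != set0.
  apply: contraTneq (rich I Id) => /eqP; rewrite setD_eq0 -leqNgt => sub.
  by apply: leq_trans (subset_leq_card sub) cbad.
rewrite inE => /andP[zbad]; rewrite inE => /andP[zE /forall_inP zI].
exists z => // i; case: (boolP (i \in I)) => iI; first by rewrite (eqP (zI i iI)) eqxx orbT.
apply/negbTE; apply: contra zbad => zi; apply/bigcupP; exists i; first by rewrite inE.
rewrite !inE zE orbC; case/orP: zi => [-> // | zi]; apply/orP; right => /=.
by apply/forall_inP => j; rewrite !inE => /orP[/eqP -> // | /zI].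
Qed.

Lemma graph_VCdim_ge (x : {ffun 'I_d -> 'rV[F]_d}) :
  (forall i, x i \in E) -> injective x ->
  (forall I : {set 'I_d}, exists2 z, z \in E &
    forall i, (z == x i) || (sqnorm (z - x i) == t) = (i \in I)) ->
  (d <= graph_VCdim (@distance_graph F d E t))%N.
Proof.
move=> xE xinj sep.
pose v i : {x | x \in E} := exist _ (x i) (xE i).
pose S := [set v i | i : 'I_d].
have cS : #|S| = d.
  by rewrite card_imset ?card_ord // => i j [/xinj].
rewrite -[leqLHS]cS; apply: leq_bigmax_cond.
apply/eqP/setP => h; rewrite [RHS]inE.
(* The labelling [h] lives on the subtype of points of [S], so it is carried to the indices by an
   existential. *)
pose I := [set i | [exists s, (val s == v i) && h s]].
have [z zE zI] := sep I.
apply/imsetP; exists (indicator (closed_neighborhood (distance_graph t) (exist _ z zE))).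
  exact: imset_f.
apply/ffunP => -[s sS]; rewrite !ffunE /=.
have /imsetP[i _ es] := sS.
rewrite !inE /distance_graph.
have -> : (s == exist _ z zE) = (z == x i) by rewrite es -val_eqE /= eq_sym.
rewrite (_ : val s = x i) ?es //= zI inE; apply/idP/existsP => [hs | [[s' s'S]] /andP[/eqP /= e hs']].
  by exists (exist _ s sS); rewrite hs andbT; apply/eqP.
by move: hs'; congr (h _); apply: val_inj; rewrite /= e es.
Qed.

End Shattering.

Theorem corollary1p5 (R : realType) (d : nat) (hd : (3 <= d)%N) :
  exists C : R, 0 < C /\
    forall F : finFieldType, odd #|F| ->
    forall E : {set 'rV[F]_d},
      C * #|F|%:R ^+ (d - 1) < #|E|%:R ->
    forall t : F, t != 0 ->
      (d <= graph_VCdim (@distance_graph F d E t))%N.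
Proof.
(* The threshold of [exists_rich_star]; as [d >= 3], it also exceeds the 368 required by
   [card_good_centres]. *)
pose c := (16 * d * 6 ^ d)%N.
have c368 : 368 <= c%:R :> rat.
  have d3 : 3 <= d%:R :> rat by rewrite ler_nat.
  have h6 : 6 ^+ 3 <= 6 ^+ d :> rat by apply: ler_weXn2l.
  by rewrite /c !natrM natrX; nra.
exists c%:R; split.
  by rewrite ltr0n !muln_gt0 expn_gt0 andbT (leq_trans _ hd).
move=> F oddF E hE t t0.
have {}hE : (c * #|F| ^ (d - 1) < #|E|)%N.
  by move: hE; rewrite -natrX -natrM ltr_nat.
have nG := card_good_centres t oddF hd c368 (ltnW hE).
have [[y x] /= pS [Mu rich]] := exists_rich_star hd t0 nG hE.
move: pS; rewrite inE /= => /andP[]; rewrite inE => /andP[yE _] /forallP h.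
have xE i : x i \in E by have := h i; rewrite inE => /andP[].
have xt i : sqnorm (y - x i) = t by have := h i; rewrite inE => /andP[_ /eqP].
apply: (graph_VCdim_ge xE) (rich_star_separates oddF t0 yE xE xt Mu rich).
(* Equal leaves would give [leaf_mx] two equal rows and determinant zero. *)
move=> i j xij; apply/eqP; apply: contraLR Mu => ij.
rewrite unitmxE unitfE negbK; apply/eqP; apply: (determinant_alternate ij) => k.
by rewrite !mxE xij.
Qed.
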